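(* Let $n\ge4$ be even, let $\Omega\subset\mathbb{R}^n$ be a bounded and strictly convex domain with smooth boundary, and let $p\ge1$, $q\ge1$ with $pq>1$. Let $(u,v)\in (C^n(\Omega)\cap C^{n-2}(\overline\Omega))^2$ be a pair of positive classical solutions to $$\begin{cases}(-\Delta)^{\frac n2}u(x)=v^p(x), & x\in\Omega,\\ (-\Delta)^{\frac n2}v(x)=u^q(x), & x\in\Omega,\\ u(x)=-\Delta u(x)=\cdots=(-\Delta)^{\frac n2-1}u(x)=0, & x\in\partial\Omega,\\ v(x)=-\Delta v(x)=\cdots=(-\Delta)^{\frac n2-1}v(x)=0, & x\in\partial\Omega.\end{cases}$$ Then for any $x^0\in\partial\Omega$, there exists a constant $\delta_0>0$ depending only on $x^0$ and $\Omega$ (in particular not on $p,q,u,v$) such that, for every $i=0,\dots,\frac n2-1$, the functions $(-\Delta)^iu$ and $(-\Delta)^iv$ are strictly monotone increasing along the inward normal direction $\nu^0$ in the region $$\tilde\Sigma_{\delta_0}=\{x\in\overline\Omega\mid 0\le (x-x^0)\cdot\nu^0\le\delta_0\}.$$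
   Context: $\nu^0$ is the unit inward normal vector of $\partial\Omega$ at $x^0$. A function $w$ is strictly monotone increasing along $\nu^0$ in a region $S$ if $w(x+t\nu^0)>w(x)$ whenever $t>0$ and $x,\,x+t\nu^0\in S$. Positive means $u,v>0$ in $\Omega$. *)

(* Defs.v *)
From HB Require Import structures.
From mathcomp Require Import all_boot all_order all_algebra.
From mathcomp Require Import all_classical all_reals all_analysis.

Set Implicit Arguments.
Unset Strict Implicit.
Unset Printing Implicit Defensive.

Import Order.TTheory GRing.Theory Num.Theory.
Import numFieldNormedType.Exports.

Local Open Scope classical_set_scope.
Local Open Scope ring_scope.

(* R^n is 'rV[R]_n. Its library norm is the sup norm, which gives the Euclidean
   topology and bounded sets; lengths and angles go through dot. *)

Definition dot (R : realType) (n : nat) (x y : 'rV[R]_n) : R :=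
  \sum_(i < n) x 0 i * y 0 i.

Definition norm2 (R : realType) (n : nat) (x : 'rV[R]_n) : R :=
  Num.sqrt (dot x x).

Definition partial (R : realType) (n : nat) (i : 'I_n) (f : 'rV[R]_n -> R) :
    'rV[R]_n -> R :=
  fun x => 'D_('e_i) f x.

(* A multi-index is a list of coordinates:
   partials [:: i; j] f = partial i (partial j f). *)
Definition partials (R : realType) (n : nat) (s : seq 'I_n)
    (f : 'rV[R]_n -> R) : 'rV[R]_n -> R :=
  foldr (@partial R n) f s.

Definition grad (R : realType) (n : nat) (f : 'rV[R]_n -> R) (x : 'rV[R]_n) :
    'rV[R]_n :=
  \row_(i < n) partial i f x.

Definition neg_laplacian (R : realType) (n : nat) (f : 'rV[R]_n -> R) :
    'rV[R]_n -> R :=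
  fun x => - \sum_(i < n) partial i (partial i f) x.

Definition polyharmonic (R : realType) (n k : nat) (f : 'rV[R]_n -> R) :
    'rV[R]_n -> R :=
  iter k (@neg_laplacian R n) f.

Definition Ck (R : realType) (n k : nat) (U : set 'rV[R]_n)
    (f : 'rV[R]_n -> R) : Prop :=
  (forall s : seq 'I_n, (size s < k)%N ->
     forall (i : 'I_n) (x : 'rV[R]_n), U x -> derivable (partials s f) x 'e_i) /\
  (forall s : seq 'I_n, (size s <= k)%N ->
     {within U, continuous (partials s f)}).

(* C^k(closure U) for U open: f is continuous on the closure and its partial
   derivatives in U of order at most k extend continuously to the closure. *)
Definition Ck_closure (R : realType) (n k : nat) (U : set 'rV[R]_n)
    (f : 'rV[R]_n -> R) : Prop :=
  [/\ Ck k U f,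
      {within closure U, continuous f} &
      forall s : seq 'I_n, (size s <= k)%N ->
        exists g : 'rV[R]_n -> R,
          {within closure U, continuous g} /\
          (forall x, U x -> g x = partials s f x)].

(* Continuous extension to closure U of a function considered on U: its limit
   from inside U. It is needed because derive gives meaningful values of
   (-Delta)^i u only in U; for f in C^0(closure U) it is f itself there. *)
Definition extend (R : realType) (n : nat) (U : set 'rV[R]_n)
    (f : 'rV[R]_n -> R) (x : 'rV[R]_n) : R :=
  lim (f y @[y --> within U (nbhs x)]).

Definition boundary (T : topologicalType) (A : set T) : set T :=
  closure A `\` interior A.

Definition domain (R : realType) (n : nat) (U : set 'rV[R]_n) : Prop :=
  [/\ open U, connected U & U !=set0].

Definition strictly_convex (R : realType) (n : nat) (U : set 'rV[R]_n) : Prop :=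
  forall (x y : 'rV[R]_n) (t : R),
    closure U x -> closure U y -> x != y -> 0 < t -> t < 1 ->
    interior U (t *: x + (1 - t) *: y).

(* rho is a smooth defining function of U on the open neighbourhood V of x0,
   positive inside U, so that grad rho is an inward normal at boundary points. *)
Definition defining_function (R : realType) (n : nat) (U : set 'rV[R]_n)
    (x0 : 'rV[R]_n) (V : set 'rV[R]_n) (rho : 'rV[R]_n -> R) : Prop :=
  [/\ open V, V x0,
      forall k : nat, Ck k V rho,
      forall x, V x -> grad rho x != 0 &
      U `&` V = [set x | V x /\ 0 < rho x]].

Definition smooth_boundary (R : realType) (n : nat) (U : set 'rV[R]_n) : Prop :=
  forall x0, boundary U x0 -> exists V rho, defining_function U x0 V rho.

Definition unit_inward_normal (R : realType) (n : nat) (U : set 'rV[R]_n)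
    (x0 nu : 'rV[R]_n) : Prop :=
  exists V rho, defining_function U x0 V rho /\
    nu = (norm2 (grad rho x0))^-1 *: grad rho x0.

Definition navier_solution (R : realType) (n : nat) (U : set 'rV[R]_n)
    (p q : R) (u v : 'rV[R]_n -> R) : Prop :=
  [/\ forall x, U x -> polyharmonic n./2 u x = v x `^ p,
      forall x, U x -> polyharmonic n./2 v x = u x `^ q,
      forall (i : nat) x, (i < n./2)%N -> boundary U x ->
        extend U (polyharmonic i u) x = 0 &
      forall (i : nat) x, (i < n./2)%N -> boundary U x ->
        extend U (polyharmonic i v) x = 0].

Definition strictly_increasing_along (R : realType) (n : nat)
    (nu : 'rV[R]_n) (S : set 'rV[R]_n) (w : 'rV[R]_n -> R) : Prop :=
  forall (x : 'rV[R]_n) (t : R),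
    0 < t -> S x -> S (x + t *: nu) -> w x < w (x + t *: nu).

Definition boundary_cap (R : realType) (n : nat) (U : set 'rV[R]_n)
    (x0 nu : 'rV[R]_n) (delta : R) : set 'rV[R]_n :=
  [set x | closure U x /\ 0 <= dot (x - x0) nu <= delta].

(* Main.v *)
Require Import Defs.
From HB Require Import structures.
From mathcomp Require Import all_boot all_order all_algebra.
From mathcomp Require Import all_classical all_reals all_analysis.
From mathcomp Require Import ring lra.

Import Order.TTheory GRing.Theory Num.Theory.
Import numFieldNormedType.Exports.

Local Open Scope classical_set_scope.
Local Open Scope ring_scope.

Set Implicit Arguments.
Unset Strict Implicit.
Unset Printing Implicit Defensive.

(** The proof is the method of moving planes, applied to the second-order
    system hidden in the polyharmonic one.  With m = n/2, the 2m functions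
    (-Delta)^i u and (-Delta)^i v, i < m, have zero boundary values and satisfy
    -Delta f_j = F_j (f_sigma(j)) for a cyclic shift sigma, where F_j is the
    identity or a power with exponent at least 1: the system is cooperative,
    because every F_j is nondecreasing.  Positivity of u and v makes every
    right-hand side positive, one component after the other, and the minimum
    principle then makes every component positive ([minimum_principle]).

    Let s(x) = (x - x0) . nu and let x^l be the mirror image of x in the
    hyperplane s = l.  The claim is that f_j x <= f_j x^l for all j, all
    0 <= l <= d and all x in Omega with s x < l; strict inequality below the
    plane is the asserted monotonicity, since x and x + t nu are mirror images
    of each other for l = s x + t/2.  The height d comes from Omega alone
    ([cap_mirror]): strict convexity squeezes the cap s <= d into a
    neighbourhood of x0 on which a defining function of Omega increases along
    nu, so mirror images of points of the cap lie in Omega.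

    Put w_j x = f_j x^l - f_j x.  The inequality w_j >= 0 is vacuous at l = 0
    and passes to limits of l, so it is enough to push it slightly beyond every
    l < d for which it holds.  Two observations make this elementary.
    First, w_j >= 0 for all j makes every w_j superharmonic, and on the part of
    the boundary of Omega strictly below the plane w_j is positive, because f_j
    vanishes at the point but not at its image.  The subharmonic barrier
    c (b - s)^2, which vanishes on the hyperplane s = b just below the plane,
    therefore gives w_j > 0 everywhere below the plane ([ordered_strict]).
    Secondly, w_j is then bounded away from 0 on the compact set
    s <= l - e/2, so when l grows a little, only a strip of width e under the
    plane has to be treated.  In a strip narrow compared with the Lipschitz
    constant M of the F_j, the function phi = 2 e^2 - (s - (l - e))^2 satisfies
    -Delta phi = 2 > M phi, and a negative minimum of w_j / phi over all j and
    the strip is impossible ([ordered_strip]).  M depends on p, q, u and v, and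
    so does the width e, but d does not.

    The maximum principles rest on a second derivative test, for a function
    ([neg_laplacian_at_min]) and for its comparison with its mirror image
    ([neg_laplacian_at_mirror_min]).  The latter needs second derivatives along
    the reflected coordinate lines, and [C1_is_derive] obtains derivatives in
    arbitrary directions from the continuity of the partial derivatives. *)

(** * Directional derivatives of C^1 functions *)

(** A mean value theorem that spares case distinctions on the sign of the
    increment, which below is a coordinate of an arbitrary direction. *)
Lemma MVT_from0 (R : realType) (g dg : R -> R) (s : R) :
  (forall r, `|r| <= `|s| -> is_derive r (1 : R) g (dg r)) ->
  exists2 r, `|r| <= `|s| & g s - g 0 = s * dg r.
Proof.
move=> gd.
have gc a b : (forall r, r \in `[a, b] -> `|r| <= `|s|) ->
    {within `[a, b], continuous g}.
  move=> abs; apply: derivable_within_continuous => r rab.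
  by have [] := gd r (abs r rab).
have [s0|s0|s0] := ltgtP s 0.
- have bd r : r \in `[s, 0] -> `|r| <= `|s|.
    by rewrite in_itv/= => /andP[sr r0]; rewrite !ler0_norm ?lerN2// ltW.
  have [r rs e] := MVT s0 (fun r h => gd r (bd r (subset_itv_oo_cc h)))
    (gc _ _ bd).
  exists r; first by apply: bd; exact: subset_itv_oo_cc.
  by rewrite -opprB e; ring.
- have bd r : r \in `[0, s] -> `|r| <= `|s|.
    by rewrite in_itv/= => /andP[r0 rs]; rewrite !ger0_norm// ltW.
  have [r rs e] := MVT s0 (fun r h => gd r (bd r (subset_itv_oo_cc h)))
    (gc _ _ bd).
  exists r; first by apply: bd; exact: subset_itv_oo_cc.
  by rewrite e; ring.
- by exists 0; rewrite ?s0 ?lexx// subrr mul0r.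
Qed.

Lemma is_derive_line (R : realType) (n : nat) (f : 'rV[R]_n -> R)
    (x a : 'rV[R]_n) (t l : R) :
  is_derive (x + t *: a) a f l ->
  is_derive t (1 : R) (fun t : R => f (x + t *: a)) l.
Proof.
move=> [fd fl].
have e : (fun h : R => h^-1 *:
      (((fun t : R => f (x + t *: a)) \o shift t) (h *: (1 : R)) - f (x + t *: a))) =
    (fun h => h^-1 *: ((f \o shift (x + t *: a)) (h *: a) - f (x + t *: a))).
  apply/funext => h /=; congr (_ *: (f _ - _)).
  by rewrite scalerDl addrCA /GRing.scale /= mulr1.
by split; [rewrite /derivable e|rewrite /derive e].
Qed.

Lemma is_derive_cvg (R : realType) (n : nat) (f : 'rV[R]_n -> R)
    (x a : 'rV[R]_n) (l : R) :
  (fun h => h^-1 *: (f (h *: a + x) - f x)) @ (0 : R)^' --> l <->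
  is_derive x a f l.
Proof.
split=> [cv|[cv <-//]].
by split; [apply: cvgP; exact: cv|exact: cvg_lim].
Qed.

(** A path from x to x + h (c e_i + v) can go along h v first.  The last
    segment is parallel to e_i, where the mean value theorem applies to the
    i-th partial derivative, and continuity of the latter at x gives the
    limit. *)
Lemma is_derive_add_delta (R : realType) (n : nat) (f : 'rV[R]_n -> R)
    (x v : 'rV[R]_n) (i : 'I_n) (c l : R) :
  (\forall y \near x, derivable f y 'e_i) ->
  {for x, continuous (partial i f)} ->
  is_derive x v f l -> is_derive x (c *: 'e_i + v) f (c * partial i f x + l).
Proof.
move=> fd fc /is_derive_cvg fv; apply/is_derive_cvg.
have -> : (fun h : R => h^-1 *: (f (h *: (c *: 'e_i + v) + x) - f x)) =
    (fun h => h^-1 *: (f (h *: v + x + (h * c) *: 'e_i) - f (h *: v + x))) +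
    (fun h => h^-1 *: (f (h *: v + x) - f x)).
  apply/funext => h; rewrite -[RHS]scalerDr addrA subrK.
  by congr (_ *: (f _ - _)); rewrite scalerDr scalerA -addrA addrC.
apply: cvgD fv.
apply/cvgrPdist_le => e e0.
have e1 : 0 < e / (1 + `|c|) by rewrite divr_gt0// ltr_pwDl.
have /cvgrPdist_le/(_ _ e1) fce := fc.
have [d /= d0 dP] := (nbhs_ballP x _).1 (filterI fd fce).
have vx : (fun h : R => `|h| * `|v| + `|h| * `|c|) @ (0 : R)^' --> (0 : R).
  have : (fun h : R => `|h| * `|v| + `|h| * `|c|) @ (0 : R) -->
      `|0 : R| * `|v| + `|0 : R| * `|c|.
    by apply: cvgD; apply: cvgMr_tmp; apply: cvg_norm; exact: cvg_id.
  by rewrite normr0 !mul0r addr0; apply: cvg_within_filter.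
near=> h.
have hd : `|h| * `|v| + `|h| * `|c| < d.
  near: h; move/cvgr_lt : vx; exact.
have h0 : h != 0 by near: h; exact: nbhs_dnbhs_neq.
have inb r : `|r| <= `|h * c| -> ball x d (h *: v + x + r *: 'e_i).
  move=> rh; rewrite -ball_normE /= -opprB normrN.
  have -> : h *: v + x + r *: 'e_i - x = h *: v + r *: 'e_i.
    by rewrite addrAC addrK.
  apply: le_lt_trans hd; apply: (le_trans (ler_normD _ _)).
  rewrite !normrZ lerD2l -normrM (le_trans _ rh)//.
  rewrite ler_piMr// [leLHS]/Num.norm/= mx_normrE; apply: bigmax_le => // -[j k] _.
  by rewrite mxE/=; case: (_ && _); rewrite ?normr1 ?normr0.
have [|r rh] := @MVT_from0 R (fun r => f (h *: v + x + r *: 'e_i))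
    (fun r => partial i f (h *: v + x + r *: 'e_i)) (h * c).
  move=> r rh; apply: is_derive_line; apply: derivableP.
  by have [] := dP _ (inb r rh).
rewrite /= scale0r addr0 => ->.
rewrite /GRing.scale/= -mulrA mulKf//.
rewrite -mulrBr normrM.
have := (dP _ (inb r rh)).2.
rewrite ler_pdivlMr ?ltr_pwDl// mulrC => /(le_trans _); apply.
by rewrite ler_wpM2r// lerDr.
Unshelve. all: by end_near. Qed.

(** Only coordinate derivatives are given by the regularity classes; this
    makes them determine the derivatives in all directions, one coordinate of
    the direction at a time. *)
Lemma C1_is_derive (R : realType) (n : nat) (f : 'rV[R]_n -> R)
    (x v : 'rV[R]_n) :
  (forall i, \forall y \near x, derivable f y 'e_i) ->
  (forall i, {for x, continuous (partial i f)}) ->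
  is_derive x v f (\sum_i v 0 i * partial i f x).
Proof.
move=> fd fc; rewrite {1}[v]row_sum_delta.
elim/big_rec2: _ => [|i l w _ fw]; first exact: is_derive0.
exact: is_derive_add_delta.
Qed.

(** * Second derivatives at a minimum, and mirror images *)

Lemma Ck_continuous_at (R : realType) (n k : nat) (U : set 'rV[R]_n)
    (f : 'rV[R]_n -> R) (s : seq 'I_n) (x : 'rV[R]_n) :
  open U -> Ck k U f -> (size s <= k)%N -> U x ->
  {for x, continuous (partials s f)}.
Proof.
move=> oU [_ fc] sk Ux.
have := fc s sk; rewrite continuous_open_subspace// => /(_ x).
by apply; rewrite inE.
Qed.

Lemma Ck_is_derive (R : realType) (n k : nat) (U : set 'rV[R]_n)
    (f : 'rV[R]_n -> R) (s : seq 'I_n) (x v : 'rV[R]_n) :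
  open U -> Ck k U f -> (size s < k)%N -> U x ->
  is_derive x v (partials s f) (\sum_i v 0 i * partial i (partials s f) x).
Proof.
move=> oU fk sk Ux; apply: C1_is_derive => i.
  have : nbhs x U by exact: open_nbhs_nbhs.
  by apply: filterS => y Uy; exact: fk.1.
exact: (@Ck_continuous_at _ _ _ _ _ (i :: s) _ oU fk sk Ux).
Qed.

(** If l < 0 then h' is negative just to the right of its zero 0, so h
    decreases there, against minimality. *)
Lemma second_derivative_test (R : realType) (h h' : R -> R) (l : R) :
  (\forall t \near 0, is_derive t (1 : R) h (h' t)) ->
  is_derive 0 (1 : R) h' l -> (\forall t \near 0, h 0 <= h t) -> 0 <= l.
Proof.
move=> hd h'd hmin; rewrite leNgt; apply/negP => l0.
have [d /= d0 dP] := (nbhs_ballP (0 : R) _).1 (filterI hd hmin).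
have inb t : t \in `](- d), d[ -> ball (0 : R) d t.
  by rewrite in_itv/= -ball_normE/= sub0r normrN ltr_norml.
have h'0 : h' 0 = 0.
  have h0 : is_derive (0 : R) (1 : R) h 0.
    apply: (@derive1_at_min _ h (- d) d).
    - by rewrite ge0_cp// ltW.
    - by move=> t /inb/dP[[]].
    - by rewrite in_itv/= oppr_lt0 d0.
    - by move=> t /inb/dP[].
  have [+ _] := dP 0 (ballxx _ d0).
  by move=> /@derive_val <-; exact: derive_val.
have [h'dd h'v] := h'd.
have : (fun t => t^-1 *: (h' (t *: (1 : R) + 0) - h' 0)) @ (0 : R)^' --> l.
  by rewrite -h'v; exact: h'dd.
move=> /cvgr_lt/(_ _ l0); rewrite near_withinE => h'neg.
have [e /= e0 eP] := (nbhs_ballP (0 : R) _).1 h'neg.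
(* Both the derivative of h and the comparison h' < 0 are available on ]0, t]. *)
pose t := Num.min d e / 2.
have m0 : 0 < Num.min d e by rewrite lt_min d0.
have t0 : 0 < t by rewrite divr_gt0.
have tm : t < Num.min d e by rewrite /t; lra.
have [td te] : t < d /\ t < e by move: tm; rewrite lt_min => /andP.
have inb' r : 0 <= r <= t -> ball (0 : R) d r.
  by move=> r0t; apply: inb; rewrite in_itv/=; lra.
have [r||r] := @MVT R h h' 0 t t0.
- by rewrite in_itv/= => /andP[r0 rt]; apply: (dP r _).1; apply: inb'; lra.
- apply: derivable_within_continuous => r; rewrite in_itv/= => r0t.
  by have [] := (dP r (inb' _ r0t)).1.
rewrite in_itv/= subr0 => /andP[r0 rt] e1.
have tb : ball (0 : R) d t by apply: inb; rewrite in_itv/=; lra.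
have := (dP t tb).2; rewrite -subr_ge0 e1 pmulr_lge0// leNgt => /negP; apply.
have re : ball (0 : R) e r.
  by rewrite -ball_normE/= sub0r normrN gtr0_norm//; lra.
have := eP r re; rewrite gt_eqF// => /(_ isT).
by rewrite h'0 subr0 addr0 [_ *: 1]mulr1 pmulr_rlt0// invr_gt0.
Qed.

(** The mirror image of x in the hyperplane dot (x - x0) nu = l, for a unit
    vector nu. *)
Definition mirror (R : realType) (n : nat) (x0 nu : 'rV[R]_n) (l : R)
    (x : 'rV[R]_n) : 'rV[R]_n :=
  x + (2 * (l - dot (x - x0) nu)) *: nu.

(** The second derivative of f at x along a. *)
Definition hess (R : realType) (n : nat) (f : 'rV[R]_n -> R)
    (x a : 'rV[R]_n) : R :=
  \sum_i a 0 i * \sum_j a 0 j * partial j (partial i f) x.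

(** The derivative is kept as a combination of partial derivatives, which are
    themselves of class C^1, so that [C2_line2] can differentiate once
    more. *)
Lemma C2_line1 (R : realType) (n : nat) (U : set 'rV[R]_n)
    (f : 'rV[R]_n -> R) (x a : 'rV[R]_n) (t : R) :
  open U -> Ck 2 U f -> U (x + t *: a) ->
  is_derive t (1 : R) (fun t : R => f (x + t *: a))
    (\sum_i a 0 i * partial i f (x + t *: a)).
Proof.
move=> oU fk Ux; apply: is_derive_line.
exact: (@Ck_is_derive _ _ _ _ f [::] _ _ oU fk).
Qed.

Lemma C2_line2 (R : realType) (n : nat) (U : set 'rV[R]_n)
    (f : 'rV[R]_n -> R) (x a : 'rV[R]_n) :
  open U -> Ck 2 U f -> U x ->
  is_derive (0 : R) (1 : R)
    (fun t : R => \sum_i a 0 i * partial i f (x + t *: a)) (hess f x a).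
Proof.
move=> oU fk Ux.
have x0E : x = x + (0 : R) *: a by rewrite scale0r addr0.
have -> : (fun t : R => \sum_i a 0 i * partial i f (x + t *: a)) =
   \sum_i (a 0 i \*: (fun t : R => partial i f (x + t *: a))).
  by apply/funext => t; rewrite fct_sumE.
apply: is_derive_sum => i; apply: is_deriveZ.
apply: is_derive_line; rewrite -x0E.
exact: (@Ck_is_derive _ _ _ _ f [:: i] _ _ oU fk).
Qed.

Lemma dotDl (R : realType) (n : nat) (x y z : 'rV[R]_n) :
  dot (x + y) z = dot x z + dot y z.
Proof.
by rewrite /dot -big_split/=; apply: eq_bigr => i _; rewrite mxE mulrDl.
Qed.

Lemma dotZl (R : realType) (n : nat) (c : R) (x z : 'rV[R]_n) :
  dot (c *: x) z = c * dot x z.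
Proof.
by rewrite /dot mulr_sumr; apply: eq_bigr => i _; rewrite mxE mulrA.
Qed.

Lemma sum_delta (R : realType) (n : nat) (i : 'I_n) (F : 'I_n -> R) :
  \sum_(j < n) ('e_i : 'rV_n) 0 j * F j = F i.
Proof.
rewrite (bigD1 i)// big1 => [|j ji].
  by rewrite mxE !eqxx mul1r /= addr0.
by rewrite mxE eqxx (negbTE ji) mul0r.
Qed.

Lemma dot_delta (R : realType) (n : nat) (i : 'I_n) (z : 'rV[R]_n) :
  dot 'e_i z = z 0 i.
Proof. exact: sum_delta. Qed.

(** Mirroring is affine; its linear part is the reflection
    a - 2 (a . nu) nu. *)
Lemma mirror_line (R : realType) (n : nat) (x0 nu : 'rV[R]_n) (l t : R)
    (x a : 'rV[R]_n) :
  mirror x0 nu l (x + t *: a) =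
  mirror x0 nu l x + t *: (a - (2 * dot a nu) *: nu).
Proof.
rewrite /mirror (addrAC x _ (- x0)) (dotDl (x - x0)) dotZl.
by apply/rowP => i; rewrite !mxE; ring.
Qed.

Lemma hess_delta (R : realType) (n : nat) (f : 'rV[R]_n -> R)
    (x : 'rV[R]_n) (i : 'I_n) :
  hess f x 'e_i = partial i (partial i f) x.
Proof. by rewrite /hess !sum_delta. Qed.

Lemma sum_hess_delta (R : realType) (n : nat) (f : 'rV[R]_n -> R)
    (x : 'rV[R]_n) :
  \sum_i hess f x 'e_i = - neg_laplacian f x.
Proof.
by rewrite /neg_laplacian opprK; apply: eq_bigr => i _; exact: hess_delta.
Qed.

(** The reflected coordinate vectors form an orthonormal basis, and the trace
    of a quadratic form does not depend on the orthonormal basis. *)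
Lemma sum_hess_mirror (R : realType) (n : nat) (f : 'rV[R]_n -> R)
    (x nu : 'rV[R]_n) : dot nu nu = 1 ->
  \sum_i hess f x ('e_i - (2 * dot 'e_i nu) *: nu) = - neg_laplacian f x.
Proof.
move=> nu1; rewrite /neg_laplacian opprK /hess exchange_big/=.
apply: eq_bigr => k _.
under eq_bigr do rewrite mulr_sumr.
rewrite exchange_big/=.
transitivity (\sum_(l < n) (k == l)%:R * partial l (partial k f) x).
  apply: eq_bigr => l _.
  under eq_bigr do rewrite mulrA.
  rewrite -mulr_suml; congr (_ * _).
  under eq_bigr do rewrite dot_delta !mxE/=.
  transitivity (\sum_(i < n) ((k == i)%:R * (l == i)%:R
     - (2 * nu 0 l) * ((k == i)%:R * nu 0 i)
     - (2 * nu 0 k) * ((l == i)%:R * nu 0 i)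
     + (4 * nu 0 k * nu 0 l) * (nu 0 i * nu 0 i))).
    by apply: eq_bigr => i _; ring.
  have pick (j : 'I_n) (F : 'I_n -> R) : \sum_(i < n) (j == i)%:R * F i = F j.
    rewrite (bigD1 j)//= big1 ?addr0 ?eqxx ?mul1r// => i ij.
    by rewrite eq_sym (negbTE ij) mul0r.
  rewrite big_split/= !sumrB -!mulr_sumr !pick.
  rewrite -[X in _ + _ * X]/(dot nu nu) nu1 eq_sym; ring.
rewrite (bigD1 k)//= big1 ?addr0 ?eqxx ?mul1r// => i ik.
by rewrite eq_sym (negbTE ik) mul0r.
Qed.

Lemma neg_laplacian_at_min (R : realType) (n : nat) (U : set 'rV[R]_n)
    (f : 'rV[R]_n -> R) (y : 'rV[R]_n) :
  open U -> Ck 2 U f -> U y -> (\forall x \near y, f y <= f x) ->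
  neg_laplacian f y <= 0.
Proof.
move=> oU fk Uy fmin; rewrite -oppr_ge0 -sum_hess_delta.
apply: sumr_ge0 => i _.
have lc : (fun t : R => y + t *: 'e_i) @ (0 : R) --> y.
  rewrite -{2}[y]addr0 -(scale0r 'e_i).
  by apply: cvgD; [exact: cvg_cst|apply: cvgZr_tmp; exact: cvg_id].
apply: (@second_derivative_test R (fun t => f (y + t *: 'e_i)) _ _ _
  (C2_line2 'e_i oU fk Uy)).
  have : \forall t \near (0 : R), U (y + t *: 'e_i).
    by apply: lc; exact: open_nbhs_nbhs.
  by apply: filterS => t; exact: C2_line1.
have : \forall t \near (0 : R), f y <= f (y + t *: 'e_i) by exact: lc fmin.
by apply: filterS => t /=; rewrite scale0r addr0.
Qed.

(** At a minimum y of w the second derivative of w along every coordinate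
    direction is nonnegative; summing over the directions, the mirrored term
    contributes the Laplacian at the image of y by [sum_hess_mirror], and the
    quadratic term contributes 2 c because nu is a unit vector.  The quadratic
    polynomial in dot (x - x0) nu is the common shape of the barriers used
    below. *)
Lemma neg_laplacian_at_mirror_min (R : realType) (n : nat) (U : set 'rV[R]_n)
    (f : 'rV[R]_n -> R) (x0 nu y : 'rV[R]_n) (l a b c : R) :
  open U -> Ck 2 U f -> dot nu nu = 1 -> U y -> U (mirror x0 nu l y) ->
  let w x := f (mirror x0 nu l x) - f x
    + (a + c * (dot (x - x0) nu - b) ^+ 2) in
  (\forall x \near y, w y <= w x) ->
  neg_laplacian f (mirror x0 nu l y) <= neg_laplacian f y + 2 * c.
Proof.
move=> oU fk nu1 Uy Uz w wmin; set z := mirror _ _ _ y in Uz *.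
(* Each term is the second derivative at y of w along a coordinate vector. *)
suff : 0 <= \sum_i (hess f z ('e_i - (2 * dot 'e_i nu) *: nu) - hess f y 'e_i
      + 2 * c * (nu 0 i * nu 0 i)).
  rewrite big_split/= sumrB -mulr_sumr.
  rewrite [X in 0 <= X - _ + _](sum_hess_mirror f z nu1).
  rewrite [X in 0 <= _ - X + _](sum_hess_delta f y).
  rewrite [X in 0 <= _ + _ * X](_ : _ = 1); last exact: nu1.
  by move: (neg_laplacian f z) (neg_laplacian f y) => Lz Ly; lra.
apply: sumr_ge0 => i _.
have lc x v : (fun t : R => x + t *: v) @ (0 : R) --> (x : 'rV[R]_n).
  rewrite -{2}[x]addr0 -(scale0r v).
  by apply: cvgD; [exact: cvg_cst|apply: cvgZr_tmp; exact: cvg_id].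
set v := 'e_i - _.
have wE (t : R) : w (y + t *: 'e_i) =
    f (z + t *: v) - f (y + t *: 'e_i)
    + (a + c * (dot (y - x0) nu + t * nu 0 i - b) ^+ 2).
  rewrite /w mirror_line -/z -/v (addrAC y _ (- x0)) (dotDl (y - x0)).
  by rewrite dotZl dot_delta.
apply: (@second_derivative_test R (fun t => w (y + t *: 'e_i))
  (fun t => \sum_j v 0 j * partial j f (z + t *: v)
    - \sum_j 'e_i 0 j * partial j f (y + t *: 'e_i)
    + 2 * c * nu 0 i * (dot (y - x0) nu + t * nu 0 i - b))).
- have Uz' : \forall t \near (0 : R), U (z + t *: v).
    by apply: lc; exact: open_nbhs_nbhs.
  have Uy' : \forall t \near (0 : R), U (y + t *: 'e_i).
    by apply: lc; exact: open_nbhs_nbhs.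
  apply: filterS2 Uz' Uy' => t Uz' Uy'.
  rewrite (_ : (fun t => w _) = (fun t : R => f (z + t *: v))
    - (fun t : R => f (y + t *: 'e_i))
    + (fun t : R => (a + c * (dot (y - x0) nu + t * nu 0 i - b) ^+ 2))); last first.
    by apply/funext => r; rewrite wE.
  apply: is_deriveD; first by apply: is_deriveB; exact: C2_line1 fk _.
  apply: is_derive_eq; rewrite /GRing.scale/=; ring.
- apply: is_deriveD; first by apply: is_deriveB; exact: C2_line2 fk _.
  apply: is_derive_eq; rewrite /GRing.scale/=; ring.
- have : \forall t \near (0 : R), w y <= w (y + t *: 'e_i) by exact: lc wmin.
  by apply: filterS => t /=; rewrite scale0r addr0.
Qed.

(** * Geometry of small caps *)

Lemma continuous_sum_at (R : realType) (T : topologicalType) (n : nat)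
    (F : 'I_n -> T -> R) (x : T) :
  (forall i, {for x, continuous (F i)}) ->
  {for x, continuous (fun y => \sum_i F i y)}.
Proof.
move=> Fc; apply: cvg_big => // [|i _]; first exact: add_continuous.
exact: Fc.
Qed.

Lemma closure_compact (R : realType) (n : nat) (U : set 'rV[R]_n) :
  bounded_set U -> compact (closure U).
Proof.
move=> [M [_ MU]].
have cU : closure U `<=` [set x : 'rV[R]_n | `|x| <= M + 1].
  rewrite closureE => x; apply; split; last first.
    by move=> y Uy /=; apply: MU => //; rewrite ltrDl.
  apply: (@preimage_closed _ _ (fun x : 'rV[R]_n => `|x|) [set r | r <= M + 1]).
    by move=> y _; exact: norm_continuous.
  exact: closed_le.
apply: bounded_closed_compact; last exact: closed_closure.
exists (M + 1); split; first exact: num_real.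
by move=> N MN x /cU/= xM; apply: le_trans xM (ltW MN).
Qed.

Lemma dot_continuous (R : realType) (n : nat) (x0 nu : 'rV[R]_n) :
  continuous (fun x : 'rV[R]_n => dot (x - x0) nu).
Proof.
move=> x; rewrite /dot; apply: continuous_sum_at => i.
have c : {for x, continuous ((fun y : 'rV[R]_n => y 0 i) \o (fun y => y - x0))}.
  apply: continuous_comp; last exact: coord_continuous.
  by apply: continuousB => //; exact: cst_continuous.
exact: cvgMr_tmp c.
Qed.

Lemma dotC (R : realType) (n : nat) (x y : 'rV[R]_n) : dot x y = dot y x.
Proof. by apply: eq_bigr => i _; rewrite mulrC. Qed.

Lemma dot_ge0 (R : realType) (n : nat) (x : 'rV[R]_n) : 0 <= dot x x.
Proof. by apply: sumr_ge0 => i _; rewrite -expr2 sqr_ge0. Qed.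

Lemma norm2_gt0 (R : realType) (n : nat) (x : 'rV[R]_n) : x != 0 -> 0 < norm2 x.
Proof.
move=> x0; rewrite sqrtr_gt0 lt_def dot_ge0 andbT.
apply: contraNneq x0 => /eqP; rewrite psumr_eq0; last first.
  by move=> i _; rewrite -expr2 sqr_ge0.
move=> /allP xx0; apply/eqP/rowP => i; rewrite mxE.
have /= := xx0 i (mem_index_enum i); rewrite mulf_eq0 => /orP[] /eqP//.
Qed.

Lemma norm2_sqr (R : realType) (n : nat) (x : 'rV[R]_n) :
  norm2 x ^+ 2 = dot x x.
Proof. by rewrite sqr_sqrtr// dot_ge0. Qed.

Lemma dot_normalize (R : realType) (n : nat) (x : 'rV[R]_n) : x != 0 ->
  let nu := (norm2 x)^-1 *: x in dot nu nu = 1.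
Proof.
move=> /norm2_gt0 x0 nu; rewrite dotZl dotC dotZl -norm2_sqr.
by rewrite expr2 mulKf ?gt_eqF// mulVf// gt_eqF.
Qed.

Section cap_geometry.
Variables (R : realType) (n : nat) (U V : set 'rV[R]_n) (x0 : 'rV[R]_n).
Variable rho : 'rV[R]_n -> R.
Hypotheses (oU : open U) (bU : bounded_set U) (convU : strictly_convex U).
Hypotheses (x0U : boundary U x0) (rhoP : defining_function U x0 V rho).

Let nu := (norm2 (grad rho x0))^-1 *: grad rho x0.
Let s (x : 'rV[R]_n) := dot (x - x0) nu.

Let oV : open V. Proof. by case: rhoP. Qed.
Let Vx0 : V x0. Proof. by case: rhoP. Qed.
Let g0 : 0 < norm2 (grad rho x0).
Proof. by case: rhoP => _ _ _ /(_ _ Vx0) /norm2_gt0. Qed.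

Let rhoU x : V x -> (0 < rho x) = `[< U x >].
Proof.
move=> Vx; case: rhoP => _ _ _ _ UV; apply/idP/asboolP => [r0|Ux].
  by have [] : (U `&` V) x by rewrite UV.
by have : (U `&` V) x by []; rewrite UV => -[].
Qed.

Let rho_derive x v : V x -> is_derive x v rho (dot v (grad rho x)).
Proof.
move=> Vx; case: rhoP => _ _ /(_ 1%N) rho1 _ _.
have := @Ck_is_derive _ _ _ _ rho [::] x v oV rho1 isT Vx.
rewrite (_ : \sum_i _ = dot v (grad rho x))//.
by apply: eq_bigr => i _; rewrite mxE.
Qed.

Let U_int : interior U = U. Proof. exact/interior_id. Qed.

Let rhox0 : rho x0 <= 0.
Proof. by rewrite leNgt rhoU//; apply/asboolPn; rewrite -{1}U_int; case: x0U. Qed.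

Let s_ge0 x : closure U x -> x != x0 -> 0 <= s x.
Proof.
move=> cx xx0; rewrite leNgt; apply/negP => sx.
have dx : dot (x - x0) (grad rho x0) < 0.
  by move: sx; rewrite /s /nu dotC dotZl dotC pmulr_rlt0// invr_gt0.
have /is_derive_cvg := rho_derive (x - x0) Vx0.
move=> /cvgr_lt/(_ _ dx); rewrite near_withinE => qneg.
have lc : (fun t : R => t *: (x - x0) + x0) @ (0 : R) --> x0.
  rewrite -{3}[x0]add0r -(scale0r (x - x0)).
  by apply: cvgD; [apply: cvgZr_tmp; exact: cvg_id|exact: cvg_cst].
have Vn : \forall t \near (0 : R), V (t *: (x - x0) + x0).
  by apply: lc; exact: open_nbhs_nbhs.
have [e /= e0 eP] := (nbhs_ballP (0 : R) _).1 (filterI qneg Vn).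
pose t := Num.min e 1 / 2.
have m0 : 0 < Num.min e 1 by rewrite lt_min e0/=.
have t0 : 0 < t by rewrite divr_gt0.
have tm : t < Num.min e 1 by rewrite /t; lra.
have [te t1] : t < e /\ t < 1 by move: tm; rewrite lt_min => /andP.
have bt : ball (0 : R) e t by rewrite -ball_normE/= sub0r normrN gtr0_norm.
have [+ Vt] := eP t bt; rewrite gt_eqF// => /(_ isT).
rewrite [_ *: _]mulrC pmulr_llt0 ?invr_gt0// subr_lt0 => r0.
have : U (t *: (x - x0) + x0).
  rewrite -U_int (_ : _ + _ = t *: x + (1 - t) *: x0); last first.
    by apply/rowP => i; rewrite !mxE; ring.
  by apply: convU => //; case: x0U.
by move=> /asboolP; rewrite -rhoU// ltNge (le_trans (ltW r0)).
Qed.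

Let nu1 : dot nu nu = 1.
Proof. by apply: dot_normalize; case: rhoP => _ _ _ /(_ _ Vx0). Qed.

Let sD x t : s (x + t *: nu) = s x + t.
Proof. by rewrite /s (addrAC x _ (- x0)) (dotDl (x - x0)) dotZl nu1 mulr1. Qed.

Let s_gt0 x : closure U x -> x != x0 -> 0 < s x.
Proof.
move=> cx xx0; rewrite lt_def s_ge0// andbT; apply/eqP => sx.
(* A midpoint at height 0 would be interior, so that Omega would also contain
   points below the hyperplane. *)
pose z := 2^-1 *: x + (1 - 2^-1) *: x0.
have Uz : U z.
  by rewrite -U_int; apply: convU => //; [case: x0U|lra].
have sz : s z = 0.
  rewrite /s (_ : z - x0 = 2^-1 *: (x - x0)) ?dotZl ?[dot _ _]sx ?mulr0//.
  by apply/rowP => i; rewrite !mxE; field.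
have lc : (fun t : R => z + t *: nu) @ (0 : R) --> z.
  rewrite -{2}[z]addr0 -(scale0r nu).
  by apply: cvgD; [exact: cvg_cst|apply: cvgZr_tmp; exact: cvg_id].
have Un : \forall t \near (0 : R), U (z + t *: nu).
  by apply: lc; exact: open_nbhs_nbhs.
have [e /= e0 eP] := (nbhs_ballP (0 : R) _).1 Un.
have /eP Uze : ball (0 : R) e (- (e / 2)).
  by rewrite -ball_normE/= sub0r opprK gtr0_norm ?divr_gt0//; lra.
have zx0 : z + (- (e / 2)) *: nu != x0.
  by apply/eqP => zx0; case: x0U => _; apply; rewrite U_int -zx0.
have := s_ge0 (subset_closure Uze) zx0.
by rewrite sD sz; lra.
Qed.

(** The tangent hyperplane at x0 supports Omega: towards a point on its wrong
    side the defining function would decrease from a nonpositive value,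
    although strict convexity puts the segment inside Omega. *)
Lemma closure_halfspace x : closure U x -> 0 <= s x.
Proof.
have [->|xx0 cx] := eqVneq x x0; last exact/ltW/s_gt0.
by rewrite /s subrr -[0 : 'rV_n](scale0r 0) dotZl mul0r.
Qed.

Let rho_ge0 x : closure U x -> V x -> 0 <= rho x.
Proof.
move=> cx Vx; rewrite leNgt; apply/negP => r0.
case: rhoP => _ _ /(_ 0%N) rho0 _ _.
have rc : {for x, continuous rho} :=
  @Ck_continuous_at _ _ _ _ _ [::] _ oV rho0 isT Vx.
have nx : nbhs x (fun y => rho y < 0 /\ V y).
  by apply: filterI; [exact: cvgr_lt rc _ r0|exact: open_nbhs_nbhs].
have [y [Uy [ry Vy]]] := cx _ nx.
by have := rhoU Vy; rewrite asboolT// => ry'; move: ry; rewrite ltNge ltW.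
Qed.

(** The distance to the tangent hyperplane is positive on the compact set of
    points of the closure away from x0, so a low cap lies in a small ball
    around x0.  There the defining function is nonnegative on the closure and
    has a positive derivative along nu, so it is positive at the image. *)
Lemma cap_mirror : exists2 d : R, 0 < d &
  forall l x, l <= d -> closure U x -> s x < l -> U (mirror x0 nu l x).
Proof.
have gc : {for x0, continuous (fun x => \sum_i nu 0 i * partial i rho x)}.
  apply: continuous_sum_at => i.
  case: rhoP => _ _ /(_ 1%N) rho1 _ _.
  have c : {for x0, continuous (partial i rho)}.
    exact: (@Ck_continuous_at _ _ _ _ _ [:: i] _ oV rho1 isT Vx0).
  exact: cvgMl_tmp c.
have gx0 : 0 < \sum_i nu 0 i * partial i rho x0.
  have -> : \sum_i nu 0 i * partial i rho x0 = dot nu (grad rho x0).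
    by apply: eq_bigr => i _; congr (_ * _); rewrite mxE.
  by rewrite /nu dotZl -norm2_sqr expr2 mulKf// gt_eqF.
have gpos : \forall x \near x0, 0 < \sum_i nu 0 i * partial i rho x.
  exact: cvgr_gt gc _ gx0.
have [r /= r0 rP] := (nbhs_ballP x0 _).1
  (filterI (open_nbhs_nbhs (conj oV Vx0)) gpos).
have far : exists2 d : R, 0 < d &
    forall x, closure U x -> s x < d -> ball x0 (r / 2) x.
  pose K := closure U `&` ~` ball x0 (r / 2).
  have [K0|/set0P K0] := eqVneq K set0.
    exists 1 => // x cx _; apply: contrapT => nx.
    by have : K x by []; rewrite K0.
  have cK : compact K.
    apply: (subclosed_compact _ (closure_compact bU)); last by move=> ? [].
    apply: closedI; first exact: closed_closure.
    by apply: open_closedC; exact: ball_open.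
  have [c /set_mem[cc ncx0] cmin] := @compact_EVT_min _ _ s K K0 cK
    (continuous_subspaceT (@dot_continuous _ _ _ _)).
  exists (s c).
    apply: s_gt0 => //; apply/eqP => cx0; apply: ncx0; rewrite cx0.
    by apply: ballxx; rewrite divr_gt0.
  move=> x cx; apply: contraPP => nx; apply/negP; rewrite -leNgt.
  by apply: cmin; rewrite inE.
have [d1 d10 d1P] := far.
have N0 : 0 < 4 * (1 + `|nu|) by rewrite mulr_gt0// ltr_pwDl.
(* The image is at distance at most 2 d |nu| <= r / 2 from x. *)
pose d := Num.min d1 (r / (4 * (1 + `|nu|))).
exists d; first by rewrite lt_min d10 divr_gt0.
move=> l x; rewrite le_min => /andP[ld1 lr] cx sxl.
have xr : `|x0 - x| < r / 2.
  by have := d1P x cx (lt_le_trans sxl ld1); rewrite -ball_normE.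
have sx0 := closure_halfspace cx.
have inb t : `|t| <= `|2 * (l - s x)| -> ball x0 r (x + t *: nu).
  rewrite [leRHS]gtr0_norm; last by lra.
  move=> tl; rewrite -ball_normE/= opprD addrA.
  apply: le_lt_trans (ler_normB _ _) _; rewrite normrZ.
  have : `|t| * `|nu| <= r / 2.
    apply: (@le_trans _ _ ((2 * l) * (1 + `|nu|))).
      apply: ler_pM => //; last by rewrite lerDr.
      by apply: le_trans tl _; lra.
    by move: lr; rewrite ler_pdivlMr// mulrA; lra.
  lra.
have [|t tl] := @MVT_from0 R (fun t => rho (x + t *: nu))
    (fun t => dot nu (grad rho (x + t *: nu))) (2 * (l - s x)).
  by move=> t /inb/rP[Vt _]; apply: is_derive_line; exact: rho_derive.
rewrite scale0r addr0 => /eqP; rewrite subr_eq => /eqP e.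
have Vz : V (mirror x0 nu l x) by have [] := rP _ (inb _ (lexx _)).
apply/asboolP; rewrite -rhoU// /mirror -/(s x) e.
have Vx : V x.
  by have [] := rP x _; rewrite // -ball_normE/= (lt_le_trans xr)//; lra.
rewrite ltr_pwDl ?rho_ge0// mulr_gt0//; first by lra.
have [_] := rP _ (inb _ tl); congr (_ < _).
by apply: eq_bigr => i _; congr (_ * _); rewrite mxE.
Qed.

End cap_geometry.

(** * Moving planes for cyclic cooperative systems *)

Section moving_planes.
Variables (R : realType) (n : nat) (U : set 'rV[R]_n) (x0 nu : 'rV[R]_n).
Variables (J : finType) (sigma : J -> J).
Variables (f : J -> 'rV[R]_n -> R) (F : J -> R -> R) (M d : R).
Hypotheses (oU : open U) (bU : bounded_set U) (nu1 : dot nu nu = 1).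
Hypothesis s_ge0 : forall x, closure U x -> 0 <= dot (x - x0) nu.
Hypothesis mirrorU : forall l x, l <= d -> closure U x ->
  dot (x - x0) nu < l -> U (mirror x0 nu l x).
Hypotheses (fcont : forall j, continuous (f j)).
Hypotheses (f_out : forall j x, ~ U x -> f j x = 0).
Hypotheses (f_gt0 : forall j x, U x -> 0 < f j x).
Hypotheses (f_C2 : forall j, Ck 2 U (f j)).
Hypothesis f_eq : forall j x, U x ->
  neg_laplacian (f j) x = F j (f (sigma j) x).
Hypothesis F_homo : forall j a b, 0 < a -> a <= b -> F j a <= F j b.
Hypothesis M_ge0 : 0 <= M.
Hypothesis F_lip : forall j x y, U x -> U y -> f (sigma j) x <= f (sigma j) y ->
  F j (f (sigma j) y) - F j (f (sigma j) x) <= M * (f (sigma j) y - f (sigma j) x).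

Let s (x : 'rV[R]_n) := dot (x - x0) nu.
Let w l j x := f j (mirror x0 nu l x) - f j x.
Let ordered l := forall j x, U x -> s x < l -> 0 <= w l j x.

Let s_cont : continuous s. Proof. exact: dot_continuous. Qed.

Let w_comp (T : topologicalType) (h : T -> 'rV[R]_n) (k : T -> R) j t :
  {for t, continuous h} -> {for t, continuous k} ->
  {for t, continuous (fun t => w (k t) j (h t))}.
Proof.
move=> hc kc.
have sh : {for t, continuous (s \o h)}.
  by apply: (@continuous_comp _ _ _ h s); [exact: hc|exact: s_cont].
have sc := continuousM (@cst_continuous _ _ (2 : R) t) (continuousB kc sh).
have mc : {for t, continuous (fun t => mirror x0 nu (k t) (h t))}.
  have zc := continuousZr_tmp (a := nu) sc.
  have dc := continuousD hc zc.
  exact: dc.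
have fmc := continuous_comp mc (@fcont j _).
exact: (continuousB fmc (continuous_comp hc (@fcont j _))).
Qed.

Let w_cont l j : continuous (w l j).
Proof.
by move=> x; apply: (@w_comp _ id (fun=> l)); [exact: cvg_id|exact: cst_continuous].
Qed.

Let f_ge0 j x : 0 <= f j x.
Proof.
by have [/f_gt0/ltW //|/(f_out j) ->] := pselect (U x).
Qed.

Let s_le_closed b : closed [set x | s x <= b].
Proof.
apply: (@preimage_closed _ _ s [set r | r <= b]); first by move=> ? _; exact: s_cont.
exact: closed_le.
Qed.

Let s_ge_closed b : closed [set x | b <= s x].
Proof.
apply: (@preimage_closed _ _ s [set r | b <= r]); first by move=> ? _; exact: s_cont.
exact: closed_ge.
Qed.

Let cap_compact b : compact (closure U `&` [set x | s x <= b]).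
Proof.
apply: (subclosed_compact _ (closure_compact bU)); last by move=> ? [].
by apply: closedI; [exact: closed_closure|exact: s_le_closed].
Qed.

(** A strong maximum principle without Hopf's lemma.  On the hyperplane
    s = b, with s x < b < l, the barrier c (b - s)^2 vanishes and w is
    nonnegative; on the boundary of Omega below it, w exceeds the barrier for
    small c.  Hence a negative minimum of the difference g is interior, which
    is absurd because w is superharmonic and the barrier is strictly
    subharmonic. *)
Lemma ordered_strict l j x :
  l <= d -> ordered l -> closure U x -> s x < l -> 0 < w l j x.
Proof.
move=> ld ol cx sxl.
have w_bd y : closure U y -> s y < l -> ~ U y -> 0 < w l j y.
  move=> cy syl nUy; rewrite /w (f_out j nUy) subr0; apply: f_gt0.
  exact: mirrorU.
have [Ux|nUx] := pselect (U x); last exact: w_bd.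
pose b := (s x + l) / 2.
have sxb : s x < b by rewrite /b; lra.
have bl : b < l by rewrite /b; lra.
(* B is the part of the boundary of Omega up to the height b. *)
pose B := (closure U `&` [set y | s y <= b]) `&` ~` U.
have cB : compact B.
  apply: (subclosed_compact _ (@cap_compact b)); last by move=> ? [].
  apply: closedI; last exact: open_closedC.
  by apply: closedI; [exact: closed_closure|exact: s_le_closed].
have [e e0 eB] : exists2 e, 0 < e & forall y, B y -> e <= w l j y.
  have [B0|/set0P B0] := eqVneq B set0.
    by exists 1 => // y; rewrite B0.
  have [y /set_mem[[cy syb] nUy] ymin] := @compact_EVT_min _ _ (w l j) B B0 cB
    (continuous_subspaceT (@w_cont l j)).
  exists (w l j y); first by apply: w_bd => //; apply: le_lt_trans bl.
  by move=> z Bz; apply: ymin; rewrite inE.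
have b2 : 0 < b ^+ 2 + 1 by rewrite ltr_wpDl// sqr_ge0.
(* On the cap 0 <= s <= b, so the barrier stays below c b^2 < e there. *)
pose c := e / (b ^+ 2 + 1).
have c0 : 0 < c by rewrite divr_gt0.
pose g y := w l j y + (0 + (- c) * (s y - b) ^+ 2).
have g_cont : continuous g.
  move=> y.
  have sb := continuousB (@s_cont y) (@cst_continuous _ _ b y).
  have cb := continuousM (@cst_continuous _ _ (- c) y) (continuousM sb sb).
  exact: (continuousD (@w_cont l j y) (continuousD (@cst_continuous _ _ 0 y) cb)).
rewrite ltNge; apply/negP => wx.
have gx : g x < 0.
  rewrite /g add0r mulNr subr_lt0 (le_lt_trans wx)// mulr_gt0//.
  by rewrite exprn_even_gt0//= subr_eq0 lt_eqF.
pose D := closure U `&` [set y | s y <= b].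
have D0 : D !=set0 by exists x; split => //=; exact: ltW.
have [y /set_mem[cy syb] ymin] := @compact_EVT_min _ _ g D D0 (@cap_compact b)
    (continuous_subspaceT g_cont).
have gy : g y < 0.
  by apply: le_lt_trans gx; apply: ymin; rewrite inE; split => //=; exact: ltW.
have Uy : U y.
  apply: contrapT => nUy; move: gy; rewrite ltNge => /negP; apply.
  have /eB ey : B y by [].
  rewrite /g add0r mulNr subr_ge0 (le_trans _ ey)// /c mulrAC ler_pdivrMr//.
  rewrite ler_pM2l//; have := s_ge0 cy; rewrite -/(s y) => sy0.
  by move: syb => /= syb; nra.
have sy : s y < b.
  rewrite lt_neqAle syb andbT; apply/eqP => sy; move: gy.
  rewrite /g sy subrr expr0n/= mulr0 !addr0 ltNge => /negP; apply.
  by apply: ol => //; rewrite sy.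
have Uz : U (mirror x0 nu l y) by apply: mirrorU => //; exact: lt_trans bl.
have := @neg_laplacian_at_mirror_min _ _ U (f j) x0 nu y l 0 b (- c)
  oU (@f_C2 j) nu1 Uy Uz.
have nU : \forall z \near y, U z by exact: open_nbhs_nbhs.
have ns : \forall z \near y, s z < b by exact: cvgr_lt (@s_cont y) _ sy.
move=> /(_ _)/wrap[].
  move: nU ns; apply: filterS2 => z Uz' sz; apply: ymin; rewrite inE.
  by split; [exact: subset_closure|exact: ltW].
rewrite !f_eq// => Fle.
have : f (sigma j) y <= f (sigma j) (mirror x0 nu l y).
  by rewrite -subr_ge0; apply: ol => //; exact: lt_trans bl.
by move=> /(@F_homo j _ _ (@f_gt0 _ _ Uy)); lra.
Qed.

(** The maximum principle in a narrow strip, for the whole system at once: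
    one takes the component j and the point y at which w_j / phi is least.  If
    that value - E is negative, then w_j + E phi has a minimum 0 at y, so
    -Delta w_j <= -2 E there, whereas the equation bounds -Delta w_j from
    below by - M * 2 E e^2. *)
Lemma ordered_strip l e : l <= d -> M * e ^+ 2 < 1 -> 0 < e ->
  (forall j x, closure U x -> s x <= l - e -> 0 <= w l j x) -> ordered l.
Proof.
move=> ld Me e0 wl j0 x1 Ux1 sx1; rewrite leNgt; apply/negP => wx1.
pose C := closure U `&` [set x | s x <= l] `&` [set x | l - e <= s x].
have cC : compact C.
  apply: (subclosed_compact _ (@cap_compact l)); last by move=> ? [].
  apply: closedI; last exact: s_ge_closed.
  by apply: closedI; [exact: closed_closure|exact: s_le_closed].
pose phi y := 2 * e ^+ 2 - (s y - (l - e)) ^+ 2.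
have phi_bd y : C y -> e ^+ 2 <= phi y <= 2 * e ^+ 2.
  by move=> [[_ /= syl] /= sye]; rewrite /phi; nra.
have phi_gt0 y : C y -> 0 < phi y.
  by move=> /phi_bd/andP[+ _]; apply: lt_le_trans; rewrite exprn_gt0.
have phi_cont : continuous phi.
  move=> y.
  have sb := continuousB (@s_cont y) (@cst_continuous _ _ (l - e) y).
  exact: (continuousB (@cst_continuous _ _ _ y) (continuousM sb sb)).
(* Both ends of the strip and the boundary of Omega carry w >= 0, so the least
   value is attained at an interior point. *)
have Cx1 : C x1.
  split; first by split; [exact: subset_closure|exact: ltW].
  rewrite /= leNgt; apply/negP => se; move: wx1; rewrite ltNge => /negP; apply.
  by apply: wl; [exact: subset_closure|exact: ltW].
have mins j : exists y, C y /\ forall z, C z -> w l j y / phi y <= w l j z / phi z.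
  have [|y yC ymin] := @compact_EVT_min _ _ (fun y => w l j y / phi y) C
      (ex_intro _ x1 Cx1) cC.
    apply/subspace_continuousP => y Cy; apply: cvg_within_filter.
    apply: continuousM; first exact: w_cont.
    by apply: continuousV; [rewrite gt_eqF// phi_gt0|exact: phi_cont].
  by exists y; split; [exact: set_mem yC|move=> z Cz; apply: ymin; rewrite inE].
have [Y YP] := choice mins.
case: (@arg_minP _ _ _ j0 predT (fun j => w l j (Y j) / phi (Y j)) isT) => j _ jmin.
set y := Y j in jmin *; have [Cy ymin] := YP j; rewrite -/y in Cy ymin.
(* E > 0 because the value at x1 is already negative. *)
pose E := - (w l j y / phi y).
have E0 : 0 < E.
  rewrite oppr_gt0; apply: (@le_lt_trans _ _ (w l j0 x1 / phi x1)).
    apply: le_trans (jmin j0 isT) _; have [_] := YP j0; exact.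
  by rewrite pmulr_llt0 ?invr_gt0 ?phi_gt0.
have wE k z : C z -> - (E * phi z) <= w l k z.
  move=> Cz; rewrite -mulNr opprK -ler_pdivlMr ?phi_gt0//.
  apply: le_trans (jmin k isT) _; have [_] := YP k; exact.
have wy : w l j y = - (E * phi y).
  by rewrite -mulNr opprK divfK// gt_eqF// phi_gt0.
have wy0 : w l j y < 0 by rewrite wy oppr_lt0 mulr_gt0// phi_gt0.
have [[cy /= syl'] /= sye'] := Cy.
have Uy : U y.
  apply: contrapT => nUy; move: wy0; rewrite ltNge => /negP; apply.
  by rewrite /w (f_out j nUy) subr0.
have syl : s y < l.
  rewrite lt_neqAle syl' andbT; apply/eqP => sy; move: wy0.
  by rewrite /w /mirror -/(s y) sy subrr mulr0 scale0r addr0 subrr ltxx.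
have sye : l - e < s y.
  rewrite ltNge; apply/negP => sy; move: wy0; rewrite ltNge => /negP; apply.
  exact: wl.
have Uz : U (mirror x0 nu l y) by exact: mirrorU.
have := @neg_laplacian_at_mirror_min _ _ U (f j) x0 nu y l (E * (2 * e ^+ 2))
  (l - e) (- E) oU (@f_C2 j) nu1 Uy Uz.
have nU : \forall z \near y, U z by exact: open_nbhs_nbhs.
have ns : \forall z \near y, s z < l by exact: cvgr_lt (@s_cont y) _ syl.
have ns' : \forall z \near y, l - e < s z by exact: cvgr_gt (@s_cont y) _ sye.
rewrite /= => /(_ _)/wrap[].
  near=> z.
  rewrite -!/(s _) -[X in X + _ <= _]/(w l j y) -[X in _ <= X + _]/(w l j z).
  have Cz : C z.
    split; [split; [apply: subset_closure|apply: ltW]|apply: ltW].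
    - by near: z.
    - by near: z.
    - by near: z.
  have := wE j z Cz; rewrite wy /phi; lra.
rewrite !f_eq// => Fle.
set k := sigma j in Fle.
have wk := wE k y Cy; have /andP[_ phiy] := phi_bd _ Cy.
have [le|/ltW le] := leP (f k y) (f k (mirror x0 nu l y)).
  by have := @F_homo j _ _ (@f_gt0 _ _ Uy) le; lra.
have := F_lip Uz Uy le.
have : f k y - f k (mirror x0 nu l y) <= E * (2 * e ^+ 2).
  have : E * phi y <= E * (2 * e ^+ 2) by rewrite ler_pM2l.
  by move: wk; rewrite /w; lra.
move=> /(ler_wpM2l M_ge0).
have : E * (M * e ^+ 2) < E by rewrite gtr_pMr.
by rewrite -/k; lra.
Unshelve. all: by end_near. Qed.

(** By compactness strict inequality at l persists up to height l - e/2 for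
    nearby planes, and the remaining strip is narrow. *)
Lemma ordered_continue l : l <= d ->
  (forall j x, closure U x -> s x < l -> 0 < w l j x) ->
  exists2 eta, 0 < eta &
    forall l', l <= l' -> l' <= l + eta -> l' <= d -> ordered l'.
Proof.
move=> ld wl.
have M1 : 0 < 1 + M by rewrite ltr_wpDr.
pose e := (1 + M)^-1.
have e0 : 0 < e by rewrite invr_gt0.
have Me : M * e ^+ 2 < 1.
  have eM : M * e = 1 - e by rewrite /e; field; lra.
  by rewrite expr2 mulrA eM; nra.
pose K := closure U `&` [set x | s x <= l - e / 2].
have nK j : \forall l' \near l, K `<=` [set x | 0 < w l' j x].
  have cK := (compact_near_coveringP K).1 (@cap_compact _).
  apply: (cK R (nbhs l) (fun l' x => 0 < w l' j x)) => x [cx /= sx].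
  have wx : 0 < w l j x by apply: wl => //; lra.
  have wc : {for (x, l), continuous (fun p : 'rV[R]_n * R => w p.2 j p.1)}.
    by apply: w_comp; [exact: cvg_fst|exact: cvg_snd].
  have wn : \forall p \near (x, l), 0 < w p.2 j p.1 by exact: cvgr_gt wc _ wx.
  exact: wn.
have nJ : \forall l' \near l, forall j, K `<=` [set x | 0 < w l' j x].
  exact (@filter_forall R J (fun j l' => K `<=` [set x | 0 < w l' j x])
    (nbhs l) _ nK).
have [eta /= eta0 etaP] := (nbhs_ballP l _).1 nJ.
exists (Num.min (eta / 2) (e / 2)).
  by rewrite lt_min !divr_gt0.
move=> l' ll'; rewrite -lerBlDl le_min => /andP[l'1 l'2] l'd.
apply: (@ordered_strip l' e) => // j x cx sx; apply/ltW.
apply: etaP; last by split => //=; lra.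
by rewrite -ball_normE/= ler0_norm; lra.
Qed.

(** Continuous induction: L is the supremum of the heights up to which all
    planes have the property. *)
Lemma ordered_all l : 0 <= l -> l <= d -> ordered l.
Proof.
move=> l0 ld.
pose A := [set a | 0 <= a <= d /\ forall m, 0 <= m -> m <= a -> ordered m].
have A0 : A 0.
  split; first by rewrite lexx (le_trans l0 ld).
  move=> m m0 m0' j x Ux sx; have := s_ge0 (subset_closure Ux).
  by rewrite -/(s x); lra.
have hsA : has_sup A.
  by split; [exists 0|exists d => a [/andP[]]].
pose L := sup A.
have L0 : 0 <= L by apply: ub_le_sup A0; exact: hsA.2.
have Ld : L <= d by apply: ge_sup; [exists 0|move=> a [/andP[]]].
have ltL m : 0 <= m -> m < L -> ordered m.
  move=> m0 mL; have Lm : 0 < L - m by rewrite subr_gt0.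
  have [a [_ aP]] := sup_adherent Lm hsA.
  by rewrite -/L opprB addrCA subrr addr0 => ma; apply: aP => //; exact: ltW.
have oL : ordered L.
  move=> j x Ux sx; rewrite leNgt; apply/negP => wx.
  have wc := @w_comp _ (fun=> x) id j L (@cst_continuous _ _ _ _) (@cvg_id _ _).
  have nw : \forall m \near L, w m j x < 0 by exact: cvgr_lt wc _ wx.
  have ns : \forall m \near L, s x < m by exact: cvgr_gt (@cvg_id _ _) _ sx.
  have [e /= e0 eP] := (nbhs_ballP L _).1 (filterI nw ns).
  pose m := L - e / 2.
  have em : ball L e m.
    by rewrite -ball_normE/= /m opprB addrC subrK gtr0_norm; lra.
  have [+ sxm] := eP m em.
  rewrite ltNge => /negP; apply; apply: ltL => //; last by rewrite /m; lra.
  by apply: le_trans (ltW sxm); exact: s_ge0 (subset_closure Ux).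
have [eta eta0 etaP] := ordered_continue Ld
  (fun j x => @ordered_strict L j x Ld oL).
have LdE : L = d.
  apply/eqP; rewrite eq_le Ld /= leNgt; apply/negP => Ld'.
  pose L' := Num.min (L + eta) d.
  have LL' : L < L' by rewrite lt_min Ld' ltrDl eta0.
  suff /(ub_le_sup hsA.2) : A L' by rewrite leNgt => /negP; apply.
  split; first by rewrite (le_trans L0 (ltW LL')) ge_min lexx orbT.
  move=> m m0; rewrite le_min => /andP[mL md].
  have [mL'|mL'] := ltP m L; first exact: ltL.
  exact: etaP.
have [lL|lL] := ltP l L; first exact: ltL.
by rewrite (_ : l = L)//; apply/eqP; rewrite eq_le lL LdE ld.
Qed.

Lemma increasing_in_cap j x t :
  closure U x -> 0 < t -> s x + t <= d -> f j x < f j (x + t *: nu).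
Proof.
move=> cx t0 sxt; have sx0 := s_ge0 cx; rewrite -/(s x) in sx0.
have ld : s x + t / 2 <= d by lra.
rewrite -subr_gt0 (_ : x + t *: nu = mirror x0 nu (s x + t / 2) x).
  apply: ordered_strict => //; last by lra.
  by apply: ordered_all => //; lra.
by rewrite /mirror -/(s x); congr (_ + _ *: _); field.
Qed.

End moving_planes.

(** * Regularity and boundary values of the iterated Laplacians *)

Lemma partials_eq_on (R : realType) (n : nat) (U : set 'rV[R]_n)
    (f g : 'rV[R]_n -> R) (s : seq 'I_n) (x : 'rV[R]_n) :
  open U -> (forall y, U y -> f y = g y) -> U x ->
  partials s f x = partials s g x.
Proof.
move=> oU fg; elim: s x => [|i s IH] x Ux; first exact: fg.
apply: near_eq_derive.
by near=> y; apply: IH; near: y; exact: open_nbhs_nbhs.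
Unshelve. all: by end_near. Qed.

Lemma derivable_eq_on (R : realType) (n : nat) (U : set 'rV[R]_n)
    (f g : 'rV[R]_n -> R) (i : 'I_n) (x : 'rV[R]_n) :
  open U -> (forall y, U y -> f y = g y) -> U x ->
  derivable f x 'e_i -> derivable g x 'e_i.
Proof.
move=> oU fg Ux.
apply: near_eq_derivable.
by near=> y; apply: fg; near: y; exact: open_nbhs_nbhs.
Unshelve. all: by end_near. Qed.

Lemma within_continuous_eq (R : realType) (n : nat) (A : set 'rV[R]_n)
    (f g : 'rV[R]_n -> R) :
  (forall x, A x -> f x = g x) -> {within A, continuous f} ->
  {within A, continuous g}.
Proof.
by move=> fg; apply: subspace_eq_continuous => x /set_mem; exact: fg.
Qed.

Lemma Ck_eq_on (R : realType) (n k : nat) (U : set 'rV[R]_n)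
    (f g : 'rV[R]_n -> R) :
  open U -> (forall y, U y -> f y = g y) -> Ck k U f -> Ck k U g.
Proof.
move=> oU fg [fd fc]; split=> [s sk i x Ux|s sk].
  apply: (derivable_eq_on oU _ Ux (fd s sk i x Ux)) => y Uy.
  exact: partials_eq_on oU fg Uy.
apply: within_continuous_eq (fc s sk) => x Ux.
exact: partials_eq_on oU fg Ux.
Qed.

Lemma neg_laplacian_eq_on (R : realType) (n : nat) (U : set 'rV[R]_n)
    (f g : 'rV[R]_n -> R) (x : 'rV[R]_n) :
  open U -> (forall y, U y -> f y = g y) -> U x ->
  neg_laplacian f x = neg_laplacian g x.
Proof.
move=> oU fg Ux; rewrite /neg_laplacian; apply: congr1; apply: eq_bigr => i _.
exact: (partials_eq_on [:: i; i] oU fg Ux).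
Qed.

(** The two derivatives of the Laplacian are innermost, hence at the end of
    the multi-index. *)
Lemma partials_neg_laplacian (R : realType) (n k : nat) (U : set 'rV[R]_n)
    (f : 'rV[R]_n -> R) (s : seq 'I_n) (x : 'rV[R]_n) :
  open U -> Ck k.+2 U f -> (size s <= k)%N -> U x ->
  partials s (neg_laplacian f) x = - \sum_i partials (s ++ [:: i; i]) f x.
Proof.
move=> oU fk; elim: s x => [//|j s IH] x /= sk Ux.
pose g := - \sum_i partials (s ++ [:: i; i]) f.
have gE y : g y = - \sum_i partials (s ++ [:: i; i]) f y by rewrite /g !fctE fct_sumE.
have gs y : U y -> partials s (neg_laplacian f) y = g y.
  by move=> Uy; rewrite gE; apply: IH => //; exact: ltnW.
transitivity (partial j g x); first exact: (partials_eq_on [:: j] oU gs Ux).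
apply: derive_val.
apply: is_deriveN; apply: is_derive_sum => i; apply: derivableP.
by apply: fk.1 => //; rewrite size_cat addn2.
Qed.

Lemma Ck_neg_laplacian (R : realType) (n k : nat) (U : set 'rV[R]_n)
    (f : 'rV[R]_n -> R) :
  open U -> Ck k.+2 U f -> Ck k U (neg_laplacian f).
Proof.
move=> oU fk; have [fd fc] := fk.
have E (s : seq 'I_n) : (size s <= k)%N -> forall x, U x ->
    - \sum_i partials (s ++ [:: i; i]) f x = partials s (neg_laplacian f) x.
  by move=> sk x Ux; rewrite (partials_neg_laplacian oU fk).
split=> [s sk j x Ux|s sk].
  apply: (derivable_eq_on oU (E s (ltnW sk)) Ux).
  rewrite (_ : (fun _ => _) = - \sum_i partials (s ++ [:: i; i]) f); last first.
    by apply/funext => y; rewrite !fctE fct_sumE.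
  apply: derivableN; apply: derivable_sum => i.
  by apply: fd => //; rewrite size_cat addn2.
apply: within_continuous_eq (E s sk) _ => x.
apply: continuousN; apply: continuous_sum_at => i.
by apply: fc; rewrite size_cat addn2.
Qed.

Lemma Ck_polyharmonic (R : realType) (n k i : nat) (U : set 'rV[R]_n)
    (f : 'rV[R]_n -> R) :
  open U -> Ck (i.*2 + k) U f -> Ck k U (polyharmonic i f).
Proof.
move=> oU; elim: i k => [//|i IH] k fk /=.
by apply: Ck_neg_laplacian => //; apply: IH; rewrite !addnS.
Qed.

(** The part of [Ck_closure] that (-Delta)^i f inherits from f: the values of
    (-Delta)^i f itself outside the open set U carry no information. *)
Definition partials_extend (R : realType) (n k : nat) (U : set 'rV[R]_n)
    (f : 'rV[R]_n -> R) :=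
  forall s : seq 'I_n, (size s <= k)%N -> exists g : 'rV[R]_n -> R,
    {within closure U, continuous g} /\ (forall x, U x -> g x = partials s f x).

Lemma partials_extend_polyharmonic (R : realType) (n k i : nat)
    (U : set 'rV[R]_n) (f : 'rV[R]_n -> R) :
  open U -> Ck (i.*2 + k) U f -> partials_extend (i.*2 + k) U f ->
  partials_extend k U (polyharmonic i f).
Proof.
move=> oU; elim: i k => [//|i IH] k fk fe.
rewrite doubleS !addSn -!addnS in fk fe; move=> s sk.
have /choice[g gP] : forall j : 'I_n, exists g : 'rV[R]_n -> R,
    {within closure U, continuous g} /\
    (forall x, U x -> g x = partials (s ++ [:: j; j]) (polyharmonic i f) x).
  by move=> j; apply: (IH k.+2 fk fe); rewrite size_cat addn2.
exists (fun x => - \sum_j g j x); split.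
  move=> x; apply: continuousN; apply: continuous_sum_at => j.
  exact: (gP j).1.
move=> x Ux; rewrite (partials_neg_laplacian oU (Ck_polyharmonic oU fk))//.
by congr (- _); apply: eq_bigr => j _; exact: (gP j).2.
Qed.

(** Extension by 0 gives functions that are continuous on the whole space, so
    that compositions with mirror images raise no domain questions. *)
Definition zero_extension (R : realType) (n : nat) (U : set 'rV[R]_n)
    (f : 'rV[R]_n -> R) (x : 'rV[R]_n) : R :=
  if `[< U x >] then f x else 0.

Lemma zero_extension_in (R : realType) (n : nat) (U : set 'rV[R]_n)
    (f : 'rV[R]_n -> R) (x : 'rV[R]_n) :
  U x -> zero_extension U f x = f x.
Proof. by move=> Ux; rewrite /zero_extension asboolT. Qed.

Lemma zero_extension_out (R : realType) (n : nat) (U : set 'rV[R]_n)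
    (f : 'rV[R]_n -> R) (x : 'rV[R]_n) :
  ~ U x -> zero_extension U f x = 0.
Proof. by move=> Ux; rewrite /zero_extension asboolF. Qed.

Lemma extend_eq (R : realType) (n : nat) (U : set 'rV[R]_n)
    (f g : 'rV[R]_n -> R) (x : 'rV[R]_n) :
  {within closure U, continuous g} -> (forall y, U y -> g y = f y) ->
  closure U x -> extend U f x = g x.
Proof.
move=> /subspace_continuousP gc gf cx.
have pf : ProperFilter (within U (nbhs x)).
  by apply: within_nbhs_proper.
apply: cvg_lim => //.
have gx : g y @[y --> within U (nbhs x)] --> g x.
  apply: cvg_trans (gc x cx).
  by apply: cvg_app; apply: within_subset; exact: subset_closure.
apply: cvg_trans gx; apply: near_eq_cvg.
by rewrite near_withinE; near=> y => Uy; exact: gf.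
Unshelve. all: by end_near. Qed.

(** The continuous extension to the closure vanishes on the boundary, so it
    glues continuously with 0 outside. *)
Lemma extend_zero_extension (R : realType) (n : nat) (U : set 'rV[R]_n)
    (f : 'rV[R]_n -> R) :
  open U -> partials_extend 0 U f ->
  (forall x, boundary U x -> extend U f x = 0) ->
  (forall x, closure U x -> extend U f x = zero_extension U f x) /\
  continuous (zero_extension U f).
Proof.
move=> oU fe f0; have [g [gc gf]] := fe [::] isT.
have gE x : closure U x -> g x = zero_extension U f x.
  move=> cx; have [Ux|nUx] := pselect (U x).
    by rewrite zero_extension_in// gf.
  rewrite zero_extension_out// -(extend_eq gc gf cx); apply: f0.
  by split=> //; rewrite (interior_id _).1.
split=> [x cx|x]; first by rewrite (extend_eq gc gf cx) gE.
have /subspace_continuousP zc := within_continuous_eq gE gc.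
have [cx|ncx] := pselect (closure U x); last first.
  have nx : nbhs x (~` closure U).
    apply: open_nbhs_nbhs; split => //; apply: closed_openC.
    exact: closed_closure.
  apply/(@cvgrPdist_le _ _ _ (nbhs x)) => e e0; near=> y.
  have ncy : (~` closure U) y by near: y.
  have out z : ~ closure U z -> ~ U z by move=> ncz /subset_closure.
  by rewrite !zero_extension_out ?subrr ?normr0 ?ltW//; exact: out.
apply/(@cvgrPdist_le _ _ _ (nbhs x)) => e e0.
have /cvgrPdist_le/(_ _ e0) := zc x cx; rewrite near_withinE => nc.
have [Ux|nUx] := pselect (U x).
  have nU : nbhs x U by exact: open_nbhs_nbhs.
  near=> y; have Uy : U y by near: y.
  have := subset_closure Uy; near: y; exact: nc.
near=> y; have [cy|ncy] := pselect (closure U y).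
  by move: cy; near: y; exact: nc.
rewrite !zero_extension_out ?subrr ?normr0 ?ltW// => Uy.
by apply: ncy; exact: subset_closure.
Unshelve. all: by end_near. Qed.

(** An interior minimum over the closure would have a nonpositive
    -Delta; a nonpositive value of f inside would make the minimum interior,
    either at once or because the boundary minimum 0 is also attained
    there. *)
Lemma minimum_principle (R : realType) (n : nat) (U : set 'rV[R]_n)
    (f : 'rV[R]_n -> R) :
  open U -> bounded_set U -> continuous f -> (forall x, ~ U x -> f x = 0) ->
  Ck 2 U f -> (forall x, U x -> 0 < neg_laplacian f x) ->
  forall x, U x -> 0 < f x.
Proof.
move=> oU bU fc f0 fk fl x Ux.
have not_min y : U y -> ~ (forall z, closure U z -> f y <= f z).
  move=> Uy ymin; have := fl y Uy; apply/negP; rewrite -leNgt.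
  apply: (neg_laplacian_at_min oU fk Uy).
  have : nbhs y U by exact: open_nbhs_nbhs.
  by apply: filterS => z Uz; apply: ymin; exact: subset_closure.
have cx := subset_closure Ux.
have [y /set_mem cy ymin] := @compact_EVT_min _ _ f (closure U)
  (ex_intro _ x cx) (closure_compact bU) (continuous_subspaceT fc).
have {}ymin z : closure U z -> f y <= f z by move=> cz; apply: ymin; rewrite inE.
rewrite ltNge; apply/negP => fx.
have [Uy|nUy] := pselect (U y); first exact: not_min Uy ymin.
apply: (not_min x Ux) => z cz.
by apply: le_trans (ymin z cz); rewrite (f0 _ nUy).
Qed.

(** For p >= 1 the derivative p x^(p-1) is nondecreasing. *)
Lemma powR_lipschitz (R : realType) (p a b B : R) :
  1 <= p -> 0 < a -> a <= b -> b <= B ->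
  b `^ p - a `^ p <= p * B `^ (p - 1) * (b - a).
Proof.
move=> p1 a0 ab bB.
have pos x : x \in `[a, b] -> 0 < x.
  by rewrite in_itv/= => /andP[+ _]; exact: lt_le_trans.
have [x||x xab ->] := @MVT_segment R (fun x => x `^ p)
    (fun x => p * x `^ (p - 1)) a b ab.
- by move=> /subset_itv_oo_cc/pos x0; exact: is_derive1_powR.
- apply: derivable_within_continuous => x /pos x0.
  by have [] := is_derive1_powR p x0.
rewrite ler_wpM2r ?subr_ge0// ler_wpM2l//; first by lra.
have x0 := pos x xab; move: xab; rewrite in_itv/= => /andP[_ xb].
apply: ge0_ler_powR; rewrite ?nnegrE ?subr_ge0 ?(ltW x0) ?(le_trans xb)//.
by rewrite (le_trans (ltW x0))// (le_trans xb).
Qed.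

(** * The Navier system *)

Section navier_system.
Variables (R : realType) (m : nat) (U : set 'rV[R]_m.*2).
Variables (sol : bool -> 'rV[R]_m.*2 -> R) (expo : bool -> R).
Hypotheses (oU : open U) (bU : bounded_set U).
Hypothesis expo_ge1 : forall b, 1 <= expo b.
Hypothesis sol_Ck : forall b, Ck m.*2 U (sol b).
Hypothesis sol_ext : forall b, partials_extend (m.*2 - 2) U (sol b).
Hypothesis sol_gt0 : forall b x, U x -> 0 < sol b x.
Hypothesis sol_eq : forall b x, U x ->
  polyharmonic m (sol b) x = sol (~~ b) x `^ expo b.
Hypothesis sol_bnd : forall b i x, (i < m)%N -> boundary U x ->
  extend U (polyharmonic i (sol b)) x = 0.

Let J := (bool * 'I_m)%type.
Let sigma (j : J) : J := (j.1 (+) (j.2.+1 == m), ordS j.2).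
Let f (j : J) := zero_extension U (polyharmonic j.2 (sol j.1)).
Let F (j : J) (r : R) := if j.2.+1 == m then r `^ expo j.1 else r.

Let f_extend (j : J) :
  (forall x, closure U x -> extend U (polyharmonic j.2 (sol j.1)) x = f j x) /\
  continuous (f j).
Proof.
case: j => b i; have im := ltn_ord i.
apply: extend_zero_extension => //= [|x xU]; last exact: sol_bnd.
have sub k : (i.*2 + k <= m.*2)%N -> Ck (i.*2 + k) U (sol b).
  move=> ik; have [sd sc] := sol_Ck b; split=> s sk.
    by apply: sd; exact: leq_trans ik.
  by apply: sc; exact: leq_trans ik.
apply: partials_extend_polyharmonic => //.
  by apply: sub; rewrite addn0 leq_double ltnW.
move=> s; rewrite addn0 => si; apply: sol_ext.
by apply: leq_trans si _; rewrite -(doubleB m 1) leq_double subn1 -ltnS (ltn_predK im).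
Qed.

Let f_C2 (j : J) : Ck 2 U (f j).
Proof.
case: j => b i; have im := ltn_ord i.
apply: (Ck_eq_on oU (f := polyharmonic i (sol b))).
  by move=> y Uy; rewrite /f zero_extension_in.
apply: Ck_polyharmonic => //.
have [sd sc] := sol_Ck b.
have le2 : (i.*2 + 2 <= m.*2)%N by rewrite addn2 -doubleS leq_double.
split=> s sk; first by apply: sd; exact: leq_trans le2.
by apply: sc; exact: leq_trans le2.
Qed.

Let f_eq (j : J) x : U x -> neg_laplacian (f j) x = F j (f (sigma j) x).
Proof.
case: j => b i Ux; have im := ltn_ord i.
rewrite (neg_laplacian_eq_on (g := polyharmonic i (sol b)) oU) //; last first.
  by move=> y Uy; rewrite /f zero_extension_in.
rewrite /F /f zero_extension_in//=.
have [iE|iE] := eqVneq i.+1 m; last first.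
  by rewrite addbF modn_small// ltn_neqAle iE.
rewrite addbT -[LHS]/(polyharmonic i.+1 (sol b) x).
by rewrite {2}iE modnn {1}iE/= sol_eq.
Qed.

Let f_out (j : J) x : ~ U x -> f j x = 0.
Proof. exact: zero_extension_out. Qed.

Let f_gt0 (j : J) x : U x -> 0 < f j x.
Proof.
case: j => b i.
have [k] := ubnP (m - i); elim: k b i x => // k IH b i x mik Ux.
have im := ltn_ord i.
apply: (minimum_principle oU bU (f_extend (b, i)).2) (@f_C2 (b, i)) _ _ Ux.
  exact: f_out.
move=> y Uy; rewrite f_eq// /F /=; case: ifPn => iE.
  rewrite powR_gt0// /f zero_extension_in//= iE addbT (eqP iE) modnn /=.
  exact: sol_gt0.
rewrite /sigma; apply: IH => //=.
have i1 : (i.+1 < m)%N by rewrite ltn_neqAle iE.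
by rewrite modn_small// subnS prednK ?subn_gt0// ltnW.
Qed.

Let F_homo (j : J) a b : 0 < a -> a <= b -> F j a <= F j b.
Proof.
move=> a0 ab; rewrite /F; case: ifP => // _.
have e0 := le_trans ler01 (expo_ge1 j.1).
by apply: ge0_ler_powR => //; rewrite nnegrE ltW// (lt_le_trans a0).
Qed.

(** The Lipschitz constant of the nonlinearities on the range of the solution
    exists because the components are continuous on a compact closure; it
    enters only after the height d of the cap has been given. *)
Lemma navier_increasing (x0 nu : 'rV[R]_m.*2) (d : R) :
  dot nu nu = 1 -> (forall x, closure U x -> 0 <= dot (x - x0) nu) ->
  (forall l x, l <= d -> closure U x -> dot (x - x0) nu < l ->
     U (mirror x0 nu l x)) ->
  forall b i, (i < m)%N ->
    strictly_increasing_along nu (boundary_cap U x0 nu d)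
      (extend U (polyharmonic i (sol b))).
Proof.
move=> nu1 s_ge0 mirrorU b i im x t t0 [cx _] [cxt /andP[_ xtd]].
have bounded j : exists B, 0 <= B /\ forall y, U y -> f j y <= B.
  have cU : closure U !=set0 by exists x.
  have [y /set_mem cy ymax] := @compact_EVT_max _ _ (f j) (closure U) cU
    (closure_compact bU) (continuous_subspaceT (f_extend j).2).
  exists (Num.max 0 (f j y)); split; first by rewrite le_max lexx.
  move=> z Uz; rewrite le_max (ymax z) ?orbT// inE.
  exact: subset_closure.
have [B BP] := choice bounded.
pose M := 1 + \sum_j expo j.1 * B (sigma j) `^ (expo j.1 - 1).
have e0 j : 0 <= expo j by apply: le_trans (expo_ge1 j).
have M_ge j : expo j.1 * B (sigma j) `^ (expo j.1 - 1) <= M - 1.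
  rewrite /M addrAC subrr add0r (bigD1 j)//= lerDl sumr_ge0// => k _.
  by rewrite mulr_ge0// powR_ge0.
have M_ge1 : 1 <= M.
  by rewrite /M lerDl sumr_ge0// => k _; rewrite mulr_ge0// powR_ge0.
have F_lip j y z : U y -> U z -> f (sigma j) y <= f (sigma j) z ->
    F j (f (sigma j) z) - F j (f (sigma j) y) <= M * (f (sigma j) z - f (sigma j) y).
  move=> Uy Uz yz; rewrite /F; case: ifP => _; last first.
    by rewrite ler_peMl// subr_ge0.
  have [_ /(_ z Uz) zB] := BP (sigma j).
  apply: (le_trans (powR_lipschitz (expo_ge1 _) (f_gt0 _ Uy) yz zB)).
  rewrite ler_wpM2r ?subr_ge0// (le_trans (M_ge j))//.
  by rewrite lerBlDr lerDl.
have [fe _] := f_extend (b, Ordinal im).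
rewrite /= in fe; rewrite !fe//.
apply: (@increasing_in_cap R _ U x0 nu J sigma f F M d) => //.
- by move=> j; exact: (f_extend j).2.
- exact: le_trans M_ge1.
- move: xtd; rewrite (addrAC x _ (- x0)) (dotDl (x - x0)) dotZl nu1 mulr1.
  by [].
Qed.

End navier_system.

Theorem theorem1p3 (R : realType) (n : nat) (Omega : set 'rV[R]_n)
  (n_ge4 : (4 <= n)%N) (n_even : ~~ odd n)
  (Omega_domain : domain Omega)
  (Omega_bounded : bounded_set Omega)
  (Omega_convex : strictly_convex Omega)
  (Omega_smooth : smooth_boundary Omega)
  (x0 : 'rV[R]_n) (x0_boundary : boundary Omega x0)
  (nu0 : 'rV[R]_n) (nu0_normal : unit_inward_normal Omega x0 nu0) :
  exists delta0 : R, 0 < delta0 /\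
    forall (p q : R) (u v : 'rV[R]_n -> R),
      1 <= p -> 1 <= q -> 1 < p * q ->
      Ck n Omega u -> Ck_closure (n - 2)%N Omega u ->
      Ck n Omega v -> Ck_closure (n - 2)%N Omega v ->
      (forall x, Omega x -> 0 < u x) ->
      (forall x, Omega x -> 0 < v x) ->
      navier_solution Omega p q u v ->
      forall i : nat, (i < n./2)%N ->
        strictly_increasing_along nu0 (boundary_cap Omega x0 nu0 delta0)
          (extend Omega (polyharmonic i u)) /\
        strictly_increasing_along nu0 (boundary_cap Omega x0 nu0 delta0)
          (extend Omega (polyharmonic i v)).
Proof.
have [V [rho [rhoP nuE]]] := nu0_normal.
have oU : open Omega by case: Omega_domain.
have [d d0 dP] := cap_mirror oU Omega_bounded Omega_convex x0_boundary rhoP.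
have half := closure_halfspace oU Omega_convex x0_boundary rhoP.
rewrite -nuE in dP half.
have nu1 : dot nu0 nu0 = 1.
  by rewrite nuE; apply: dot_normalize; case: rhoP => _ Vx0 _ /(_ _ Vx0).
exists d; split => // p q u v p1 q1 _ uk [_ _ ue] vk [_ _ ve] u0 v0.
move=> [eu ev bu bv].
have nE : n = n./2.*2 by rewrite even_halfK.
move: (n./2) nE eu ev bu bv => m nE; subst n => eu ev bu bv i im.
have key := @navier_increasing R m Omega (fun b => if b then u else v)
  (fun b => if b then p else q) oU Omega_bounded.
split.
- apply: (key _ _ _ _ _ _ x0 nu0 d nu1 half dP true i im).
  + by case. + by case. + by case. + by case. + by case.
  + by case => j x jm xU; [exact: bu|exact: bv].
- apply: (key _ _ _ _ _ _ x0 nu0 d nu1 half dP false i im).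
  + by case. + by case. + by case. + by case. + by case.
  + by case => j x jm xU; [exact: bu|exact: bv].
Qed.
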